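(* Let $(\mathcal F,\mathfrak D_H)$ be a differential algebra (in the sense of the context) which is horizontally exact and of du Bois-Reymond type, let $\mathrm A$ be an index set and let $\mathbf J=(J^a_{\alpha i}\cdot D^i):\mathcal F^{\mathrm A}\to\mathcal F^{\mathbf A}$ be a horizontal differential operator with $\nabla\circ\mathbf J=0$ and $[\mathrm{ev}_{\phi},\mathbf J]=0$ for all $\phi\in\ker\nabla$. Let $\Lambda(D)=(\Lambda^{\alpha\beta}_i\cdot D^i):\mathcal E^*\to\mathcal E$ be a Lagrange skew-adjoint horizontal differential operator. Then the Jacobi identity in the strengthened form holds for $\Lambda(D)$, i.e. $$\int\langle f,[\mathrm{ev}_{\phi(g)},\Lambda(D)]h\rangle+\int\langle g,[\mathrm{ev}_{\phi(h)},\Lambda(D)]f\rangle+\int\langle h,[\mathrm{ev}_{\phi(f)},\Lambda(D)]g\rangle=0\quad\text{for all } f,g,h\in\mathcal E^*,$$ where $\phi(g)=(\mathbf J\circ\Lambda(D))g$, if and only if $$Q^{\alpha\beta\gamma}_{kl}=0\quad\text{for all }\alpha,\beta,\gamma\in\mathrm A,\ k,l\in\mathbb I,$$ where $$Q^{\alpha\beta\gamma}_{kl}=R^{\alpha\beta\gamma}_{kl}+\sum_{i,j,p}(-1)^{j}\binom{j}{p,k,l-i}D^pR^{\beta\gamma\alpha}_{ij}+\sum_{i,j,p}(-1)^{i}\binom{i}{p,k-j,l}D^pR^{\gamma\alpha\beta}_{ij},$$ $$R^{\alpha\beta\gamma}_{kl}=\sum_{a,\epsilon,i,r}\binom{i}{r}\,J^a_{\epsilon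 i}\cdot D^{i-r}\Lambda^{\epsilon\beta}_{k-r}\cdot\partial_a\Lambda^{\alpha\gamma}_l .$$ Here $a$ runs over $\mathbf A$, $\epsilon$ over $\mathrm A$, and $i,j,p,r$ over $\mathbb I$.
   Context: Notation. $\mathbb F=\mathbb R$ or $\mathbb C$; all linear operations are over $\mathbb F$. $\mathbb Z_+=\{0,1,2,\dots\}$, $\mathrm M=\{1,\dots,m\}$ with $m\geq 1$, $\mathbb I=\mathbb Z_+^{\mathrm M}$ (multi-indices). Summation over repeated upper and lower indices is assumed. Differential algebra $(\mathcal F,\mathfrak D_H)$. $\mathcal F$ is a unital associative commutative $\mathbb F$-algebra; $\mathfrak D$ is the Lie algebra (and $\mathcal F$-module) of all derivations of $\mathcal F$; it is assumed that $\mathfrak D=\mathfrak D_V\oplus_{\mathcal F}\mathfrak D_H$, where: $\mathfrak D_V$ is a Lie subalgebra with a formal $\mathcal F$-basis $\{\partial_a\mid a\in\mathbf A\}$ ($\mathbf A$ an index set, possibly infinite), $[\partial_a,\partial_b]=0$, i.e. $\mathfrak D_V$ consists of all (possibly infinite) formal sums $X^a\partial_a$ with $X^a\in\mathcal F$, uniquely represented, where for each $L\in\mathcal F$ one has $\partial_aL\neq0$ for only finitely many $a$; $\mathfrak D_H$ is a Lie subalgebra with $\mathcal F$-basis $\{D_\mu\mid\mu\in\mathrm M\}$, $[D_\mu,D_\nu]=0$; and $[D_\mu,\mathfrak D_V]\subset\mathfrak D_V$. Write $[D_\mu,\partial_a]=\Gamma^b_{\mu a}\partial_b$; it is assumed that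 for each $b\in\mathbf A$ only finitely many $\Gamma^b_{\mu a}$ are nonzero. For index sets $\mathbf A,\mathbf B$, $\mathcal F^{\mathbf A}_{\mathbf B}$ is the $\mathcal F$-module of all families $(\eta^a_b)$, $a\in\mathbf A$, $b\in\mathbf B$, with entries in $\mathcal F$; $\overset{\circ}{\mathcal F}{}^{\mathbf A}_{\mathbf B}$ is the submodule of those for which, for each upper index $a$, only finitely many $\eta^a_b\ne0$ (so $\overset{\circ}{\mathcal F}_{\mathbf B}$ consists of finitely supported families). The same applies to multiple upper or lower indices. Derivations act componentwise. Horizontal differential operators. For $i=(i^1,\dots,i^m)\in\mathbb I$ put $D^i=D_1^{i^1}\circ\dots\circ D_m^{i^m}$, $(-1)^i=(-1)^{i^1+\dots+i^m}$, $(-D)^i=(-1)^iD^i$. A horizontal differential operator is a (matrix) operator whose entries are of the form $P_i\cdot D^i$ with $P_i\in\mathcal F$, where for each fixed tuple of upper indices of the coefficient family only finitely many coefficients (over all lower indices, including $i$) are nonzero. In particular $\mathbf J$ acts by $\phi^a=J^a_{\alpha i}\cdot D^i\phi^\alpha$ with $(J^a_{\alpha i})\in\overset{\circ}{\mathcal F}{}^{\mathbf A}_{\mathrm A\mathbb I}$, and, with $\mathcal E=\mathcal F^{\mathrm A}$ and $\mathcal E^*=\overset{\circ}{\mathcal F}_{\mathrm A}$, $\Lambda(D):\mathcal E^*\to\mathcal E$ acts by $\phi^\alpha=\Lambda^{\alpha\beta}_i\cdot D^if_\beta$ with $(\Lambda^{\alpha\beta}_i)\in\overset{\circ}{\mathcal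 F}{}^{\mathrm A\mathrm A}_{\mathbb I}$. $\Lambda(D)$ is Lagrange skew-adjoint if $\Lambda^{\alpha\beta}_i\cdot D^i+(-D)^i\circ\Lambda^{\beta\alpha}_i=0$ for all $\alpha,\beta$ (sum over $i$; $\circ$ is composition of operators). The pairing is $\langle f,\phi\rangle=f_\alpha\phi^\alpha$ for $f\in\mathcal E^*,\phi\in\mathcal E$. $\nabla:\mathcal F^{\mathbf A}\to\mathcal F^{\mathbf A}_{\mathrm M}$ is $(\nabla\phi)^a_\mu=D_\mu\phi^a+\Gamma^a_{\mu b}\phi^b$. For $\phi\in\ker\nabla$, $\mathrm{ev}_\phi=\phi^a\partial_a$ (it commutes with all $D_\mu$), acting componentwise on families; commutators $[\mathrm{ev}_\phi,P(D)]$ are commutators of linear maps. $\mathrm{Div}:\mathcal F^{\mathrm M}\to\mathcal F$, $\mathrm{Div}\,\psi=D_\mu\psi^\mu$; $\int K$ denotes the class of $K\in\mathcal F$ in $\mathcal F/\operatorname{Im}\mathrm{Div}$. Horizontally exact: a horizontal differential operator $P_i\cdot D^i:\mathcal F\to\mathcal F$ is zero iff all $P_i=0$. Du Bois-Reymond type: for $K\in\mathcal F$, $\int K\cdot L=0$ for all $L\in\mathcal F$ iff $K=0$. For multi-indices, $i!=i^1!\cdots i^m!$, $\binom{i}{r}=\frac{i!}{r!(i-r)!}$ and $\binom{j}{p,q,r}=\frac{j!}{p!q!r!}$ if $p+q+r=j$ with all entries in $\mathbb I$; terms in which a multi-index would have a negative component, or where the condition $p+q+r=j$ fails, are omitted (equal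 zero). *)

(* Defs.v *)
(* Possibly infinite sums are mathcomp-classical's finitely supported ones:
   \sum_(x \in D) E is 0 when E has infinite support on D. *)
From HB Require Import structures.
From mathcomp Require Export all_boot all_order all_algebra.
From mathcomp Require Export boolp classical_sets functions cardinality fsbigop.
From mathcomp Require Export reals.
From mathcomp Require Export complex.

Set Implicit Arguments.
Unset Strict Implicit.
Unset Printing Implicit Defensive.

Export Order.TTheory GRing.Theory Num.Theory.

Local Open Scope classical_set_scope.
Local Open Scope ring_scope.

(* The underlying set of elements is {0, ..., m-1} instead of {1, ..., m}.
   Addition of multi-indices is the pointwise + of {ffun _ -> nat}. *)
Definition mindex (m : nat) := {ffun 'I_m -> nat}.

Section MultiIndex.
Variable m : nat.
Implicit Types i j p q r : mindex m.

Definition mle i j : bool := [forall mu, (i mu <= j mu)%N].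

(* Truncated; only used under the guard mle j i. *)
Definition msub i j : mindex m := [ffun mu => (i mu - j mu)%N].

Definition mdeg i : nat := (\sum_mu i mu)%N.

Definition mfact i : nat := (\prod_mu (i mu)`!)%N.

Definition mbinom i r : nat :=
  if mle r i then (mfact i %/ (mfact r * mfact (msub i r)))%N else 0%N.

Definition mtrinom j p q r : nat :=
  if p + q + r == j then (mfact j %/ (mfact p * mfact q * mfact r))%N else 0%N.

End MultiIndex.

Definition finitely_supported (T : Type) (V : zmodType) (u : T -> V) : Prop :=
  finite_set [set x | u x <> 0].

Section Derivations.
Variables (K : fieldType) (F : comAlgType K).

Definition leibniz (d : F -> F) : Prop :=
  forall x y, d (x * y) = d x * y + x * d y.

Definition lie_bracket (X Y : F -> F) : F -> F :=
  fun L => X (Y L) - Y (X L).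

Definition lie_closed (S : set (F -> F)) : Prop :=
  forall X Y, S X -> S Y -> S (lie_bracket X Y).

(* The formal sum X^a d_a, as a map of F; it is applied only to families d
   such that each L is killed by all but finitely many d a. *)
Definition formal_field (I : choiceType) (d : I -> F -> F) (X : I -> F) :
  F -> F := fun L => \sum_(a \in [set: I]) X a * d a L.

End Derivations.

(* pd a = \partial_a, Dh mu = D_mu, and Gam mu a b = \Gamma^b_{mu a}. *)
Record diffAlg (K : fieldType) (F : comAlgType K) (A : choiceType) (m : nat) :=
  DiffAlg {
  pd : A -> {linear F -> F};
  Dh : 'I_m -> {linear F -> F};
  Gam : 'I_m -> A -> A -> F;
  pd_leibniz : forall a, leibniz (pd a);
  Dh_leibniz : forall mu, leibniz (Dh mu);
  pd_fin : forall L, finitely_supported (fun a => pd a L);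
  pd_comm : forall a b, lie_bracket (pd a) (pd b) = cst 0;
  Dh_comm : forall mu nu, lie_bracket (Dh mu) (Dh nu) = cst 0;
  (* vertical and horizontal derivations span all derivations, ... *)
  der_span : forall d : {linear F -> F}, leibniz d ->
    exists X h, forall L, d L = formal_field pd X L + formal_field Dh h L;
  (* ... the sum is direct and the coefficients of each part are unique *)
  der_free : forall X h,
    (forall L, formal_field pd X L + formal_field Dh h L = 0) ->
    (forall a, X a = 0) /\ (forall mu, h mu = 0);
  vertical_lie : lie_closed (range (formal_field pd));
  horizontal_lie : lie_closed (range (formal_field Dh));
  Dh_vertical : forall mu V, range (formal_field pd) V ->
    range (formal_field pd) (lie_bracket (Dh mu) V);
  Gam_def : forall mu a,
    lie_bracket (Dh mu) (pd a) = formal_field pd (Gam mu a);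
  Gam_fin : forall b, finitely_supported (fun x : 'I_m * A => Gam x.1 x.2 b)
}.

Section HorizontalCalculus.
Variables (K : fieldType) (F : comAlgType K) (A : choiceType) (m : nat).
Variable DA : diffAlg F A m.

(* D_1^{i^1} \o ... \o D_m^{i^m} *)
Definition Dpow (i : mindex m) : F -> F :=
  \big[(fun f g : F -> F => f \o g)/id]_(mu < m) iter (i mu) (Dh DA mu).

(* P_i . D^i, summed over i; P finitely supported. *)
Definition hop (P : mindex m -> F) : F -> F :=
  fun L => \sum_(i \in [set: mindex m]) P i * Dpow i L.

(* (-D)^i \o P_i, summed over i. *)
Definition hop_adj (P : mindex m -> F) : F -> F :=
  fun L => \sum_(i \in [set: mindex m]) (-1) ^+ mdeg i * Dpow i (P i * L).

(* (P u)^b = P^b_{c i} . D^i u^c, summed over (c, i). *)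
Definition hop_mx (B C : choiceType) (P : B -> C -> mindex m -> F) :
  (C -> F) -> B -> F :=
  fun u b => \sum_(x \in [set: C * mindex m]) P b x.1 x.2 * Dpow x.2 (u x.1).

Definition nabla (phi : A -> F) (a : A) (mu : 'I_m) : F :=
  Dh DA mu (phi a) + \sum_(b \in [set: A]) Gam DA mu b a * phi b.

Definition ker_nabla : set (A -> F) :=
  [set phi | forall a mu, nabla phi a mu = 0].

Definition ev (phi : A -> F) : F -> F := formal_field (pd DA) phi.

Definition ev_fam (B : Type) (phi : A -> F) (u : B -> F) : B -> F :=
  fun b => ev phi (u b).

(* [ev_phi, P] for a map P between families. *)
Definition ev_commutator (B C : Type) (phi : A -> F)
    (P : (C -> F) -> B -> F) : (C -> F) -> B -> F :=
  fun u b => ev_fam phi (P u) b - P (ev_fam phi u) b.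

Definition Div (psi : 'I_m -> F) : F := \sum_mu Dh DA mu (psi mu).

Definition im_Div : {pred F} := [pred L | `[< range Div L >]].

Lemma im_Div_closed : zmod_closed im_Div.
Proof.
split=> [|x y]; rewrite !inE.
  exists (fun=> 0) => //; rewrite /Div big1 // => mu _; exact: linear0.
move=> [u _ <-] [v _ <-]; exists (fun mu => u mu - v mu) => //.
rewrite /Div -sumrB; apply: eq_bigr => mu _; exact: linearB.
Qed.

HB.instance Definition _ := GRing.isZmodClosed.Build F im_Div im_Div_closed.

(* The functionals F / Im Div, with \int K the class of K. *)
Definition functional := {ideal_quot im_Div}.

Definition functional_int (L : F) : functional := (\pi_functional L)%qT.

Lemma functional_int_eq0 (L : F) :
  functional_int L = 0 <-> exists psi, L = Div psi.
Proof.
have pi0 : (\pi_functional)%qT (0 : F) = 0 by rewrite piE.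
rewrite /functional_int -pi0; split=> [|[psi ->]].
  by move/eqP; rewrite -Quotient.idealrBE subr0 inE => -[psi _ <-]; exists psi.
by apply/eqP; rewrite -Quotient.idealrBE subr0 inE; exists psi.
Qed.

Definition horizontally_exact : Prop :=
  forall P : mindex m -> F, finitely_supported P ->
    (forall L, hop P L = 0) <-> (forall i, P i = 0).

Definition du_bois_reymond : Prop :=
  forall L : F, (forall M, functional_int (L * M) = 0) <-> L = 0.

Section Jacobi.
Variable I : choiceType.
Variables (J : A -> I -> mindex m -> F) (Lam : I -> I -> mindex m -> F).

(* <f, phi> for f finitely supported. *)
Definition pairing (f phi : I -> F) : F := \sum_(x \in [set: I]) f x * phi x.

Definition skew_adjoint : Prop :=
  forall al be L, hop (Lam al be) L + hop_adj (Lam be al) L = 0.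

(* phi(g) = (J \o Lambda(D)) g *)
Definition phi_of (g : I -> F) : A -> F := hop_mx J (hop_mx Lam g).

Definition jacobi_term (f g h : I -> F) : functional :=
  functional_int (pairing f (ev_commutator (phi_of g) (hop_mx Lam) h)).

(* The guards (together with those in mbinom and mtrinom) omit the terms in
   which a multi-index would have a negative component. *)
Definition Rcoef (al be ga : I) (k l : mindex m) : F :=
  \sum_(x \in [set: A * I * mindex m * mindex m])
    let: (a, ep, i, r) := x in
    if mle r i && mle r k then
      (mbinom i r)%:R * J a ep i * Dpow (msub i r) (Lam ep be (msub k r))
        * pd DA a (Lam al ga l)
    else 0.

Definition Qcoef (al be ga : I) (k l : mindex m) : F :=
  Rcoef al be ga k l
  + \sum_(x \in [set: mindex m * mindex m * mindex m])
      (let: (i, j, p) := x in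
       if mle i l then
         (-1) ^+ mdeg j * (mtrinom j p k (msub l i))%:R
           * Dpow p (Rcoef be ga al i j)
       else 0)
  + \sum_(x \in [set: mindex m * mindex m * mindex m])
      (let: (i, j, p) := x in
       if mle j k then
         (-1) ^+ mdeg i * (mtrinom i p (msub k j) l)%:R
           * Dpow p (Rcoef ga al be i j)
       else 0).

End Jacobi.

End HorizontalCalculus.

(* Main.v *)
Require Import Defs.
From mathcomp Require Import finmap ring.

Set Implicit Arguments.
Unset Strict Implicit.
Unset Printing Implicit Defensive.

Local Open Scope classical_set_scope.
Local Open Scope ring_scope.

(* For phi in the kernel of nabla, ev_phi commutes with every D_mu, so
   [ev_phi, Lambda(D)] is the operator with coefficients ev_phi(Lambda_l).
   Taking phi = phi(g) and expanding D^i(Lambda_j D^j g) by the Leibniz rule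
   turns <f, [ev_phi(g), Lambda(D)] h> into the trilinear expression
   f_al R^{al be ga}_{kl} D^k g_be D^l h_ga.  Integrating the two cyclic
   permutations by parts, so that f is no longer differentiated, produces the
   two other terms of Q by the trinomial Leibniz rule, and the Jacobi sum
   becomes \int f_al Q^{al be ga}_{kl} D^k g_be D^l h_ga.  If this vanishes
   for all f, g, h, then the du Bois-Reymond property removes f and horizontal
   exactness, applied twice, gives Q = 0. *)

(** * Families of finite support and sums over them *)

Section FiniteSums.
Implicit Types (T : choiceType) (V W : zmodType).

Lemma fs_finite T V (u : T -> V) (A : set T) :
  finite_set A -> (forall x, u x <> 0 -> A x) -> finitely_supported u.
Proof. by move=> Af uA; apply: sub_finite_set Af => x /uA. Qed.

Lemma fs_sub T V W (u : T -> V) (v : T -> W) :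
  finitely_supported u -> (forall x, u x = 0 -> v x = 0) ->
  finitely_supported v.
Proof. by move=> uf uv; apply: (fs_finite uf) => x vx /uv. Qed.

Lemma fs_mull T (F : pzRingType) (u v : T -> F) :
  finitely_supported u -> finitely_supported (fun x => u x * v x).
Proof. by move=> /fs_sub; apply=> x ->; rewrite mul0r. Qed.

Lemma fs_mulr T (F : pzRingType) (u v : T -> F) :
  finitely_supported v -> finitely_supported (fun x => u x * v x).
Proof. by move=> /fs_sub; apply=> x ->; rewrite mulr0. Qed.

Lemma fs_add T V (u v : T -> V) : finitely_supported u ->
  finitely_supported v -> finitely_supported (fun x => u x + v x).
Proof.
move=> uf vf; have : finite_set ([set x | u x <> 0] `|` [set x | v x <> 0]).
  by rewrite finite_setU.
move=> /fs_finite; apply=> x uvx; apply: contrapT.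
by move=> /not_orP[/contrapT ux /contrapT vx]; apply: uvx; rewrite ux vx addr0.
Qed.

Lemma fs_fset T V (u : T -> V) : finitely_supported u ->
  exists X : {fset T}, forall x, x \notin X -> u x = 0.
Proof.
move=> /finite_fsetP[X uX]; exists X => x xX; apply: contrapT => ux.
by have : [set x | u x <> 0] x by []; rewrite uX /= (negbTE xX).
Qed.

Lemma fsumD T V (u v : T -> V) :
  finitely_supported u -> finitely_supported v ->
  \sum_(x \in setT) (u x + v x) =
    \sum_(x \in setT) u x + \sum_(x \in setT) v x.
Proof.
move=> /fs_fset[X uX] /fs_fset[Y vY].
rewrite !(fsbigTE (X `|` Y)%fset) ?big_split// => x;
  rewrite in_fsetU negb_or => /andP[/uX xX /vY xY] //.
by rewrite xX xY addr0.
Qed.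

Lemma fsum_morph T V W (g : V -> W) (u : T -> V) :
  {morph g : x y / x + y} -> finitely_supported u ->
  g (\sum_(x \in setT) u x) = \sum_(x \in setT) g (u x).
Proof.
move=> gD /fs_fset[X uX].
have g0 : g 0 = 0 by apply: (addrI (g 0)); rewrite -gD !addr0.
by rewrite !(fsbigTE X) ?(big_morph g gD g0)// => x /uX ->.
Qed.

Lemma fsumMl T (F : pzRingType) (c : F) (u : T -> F) :
  finitely_supported u ->
  c * (\sum_(x \in setT) u x) = \sum_(x \in setT) c * u x.
Proof. by apply: fsum_morph => x y; exact: mulrDr. Qed.

Lemma fsumMr T (F : pzRingType) (c : F) (u : T -> F) :
  finitely_supported u ->
  (\sum_(x \in setT) u x) * c = \sum_(x \in setT) u x * c.
Proof. by apply: (fsum_morph (g := fun x => x * c)) => x y; exact: mulrDl. Qed.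

Lemma fsumB T V (u v : T -> V) :
  finitely_supported u -> finitely_supported v ->
  \sum_(x \in setT) (u x - v x) =
    \sum_(x \in setT) u x - \sum_(x \in setT) v x.
Proof.
move=> uf vf; rewrite fsumD//; last first.
  by apply: (fs_sub vf) => x ->; rewrite oppr0.
by rewrite (fsum_morph (g := -%R))// => x y; rewrite opprD.
Qed.

(** A sign is invertible, so both families have the same support; when that support is infinite,
    both sums take the default value 0. *)
Lemma fsumMsign T (F : pzRingType) n (u : T -> F) :
  (-1) ^+ n * (\sum_(x \in setT) u x) = \sum_(x \in setT) (-1) ^+ n * u x.
Proof.
have [uf|nuf] := pselect (finitely_supported u); first exact: fsumMl.
have dflt v : ~ finitely_supported v -> \sum_(x \in setT) (v x : F) = 0 :> F.
  by move=> nv; apply: fsbig_dflt; rewrite setTI.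
rewrite !dflt ?mulr0//; apply: contra_not nuf => /fs_sub; apply=> x.
by move=> /(congr1 (fun y => (-1) ^+ n * y)); rewrite signrMK mulr0.
Qed.

Lemma fsum_eq T V (u v : T -> V) : u =1 v ->
  \sum_(x \in setT) u x = \sum_(x \in setT) v x.
Proof. by move=> uv; apply: eq_fsbigr => x _; exact: uv. Qed.

Lemma fsum_eq0 T V (u : T -> V) : (forall x, u x = 0) ->
  \sum_(x \in setT) u x = 0.
Proof. by move=> u0; apply: fsbig1 => x _; exact: u0. Qed.

Lemma fsum_single T V (x0 : T) (u : T -> V) :
  (forall x, x != x0 -> u x = 0) -> \sum_(x \in setT) u x = u x0.
Proof.
move=> ux; rewrite (fsbigTE [fset x0]%fset) ?big_seq_fset1//.
by move=> x; rewrite in_fset1; exact: ux.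
Qed.

(** Joint finiteness is stronger than finiteness of every slice, and it is what licenses exchanging
    two sums. *)
Definition fs2 (T1 T2 : Type) V (w : T1 -> T2 -> V) : Prop :=
  finitely_supported (fun p => w p.1 p.2).

Lemma fs_slice (T1 T2 : choiceType) V (w : T1 -> T2 -> V) x :
  fs2 w -> finitely_supported (w x).
Proof.
move=> wf; apply: (fs_finite (finite_image snd wf)) => y wxy.
by exists (x, y).
Qed.

Lemma fs_fsum (T1 T2 : choiceType) V (w : T1 -> T2 -> V) :
  fs2 w ->
  finitely_supported (fun x => \sum_(y \in setT) w x y).
Proof.
move=> wf; apply: (fs_finite (finite_image fst wf)) => x wx.
apply: contrapT => nex; apply/wx/fsum_eq0 => y; apply: contrapT => wxy.
by apply: nex; exists (x, y).
Qed.

(** The joint support is a union of finite slices over the finite support of [u]. Here [u] is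
    typically a factor of [w], or an argument at whose zeros [w] vanishes. *)
Lemma fs_pair (T1 T2 : choiceType) V W (u : T1 -> W) (w : T1 -> T2 -> V) :
  finitely_supported u -> (forall x y, u x = 0 -> w x y = 0) ->
  (forall x, finitely_supported (w x)) ->
  fs2 w.
Proof.
move=> uf uw wf.
have := bigcup_finite uf
  (fun x _ => finite_image (fun y => (x, y)) (wf x)).
move=> /fs_finite; apply=> -[x y] /= wxy; exists x => /=.
  by move=> /(uw _ y).
by exists y.
Qed.

Lemma fs_swap (T1 T2 : choiceType) V (w : T1 -> T2 -> V) :
  fs2 w ->
  fs2 (fun y x => w x y).
Proof.
move=> /(finite_image (fun p => (p.2, p.1)))/fs_finite; apply=> -[y x] /= wxy.
by exists (x, y).
Qed.

Lemma fs_assoc (T1 T2 T3 : choiceType) V (w : T1 -> T2 -> T3 -> V) :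
  fs2 (fun x yz => w x yz.1 yz.2) -> fs2 (fun xy z => w xy.1 xy.2 z).
Proof.
move=> /(finite_image (fun p => ((p.1, p.2.1), p.2.2)))/fs_finite.
by apply=> -[[x y] z] /= wxyz; exists (x, (y, z)).
Qed.

(** The support lies in the product of its two projections [X1] and [X2], and both sides equal the
    finite double sum over that rectangle. *)
Lemma fsum_pair (T1 T2 : choiceType) V (w : T1 -> T2 -> V) :
  fs2 w ->
  \sum_(p \in setT) w p.1 p.2 = \sum_(x \in setT) \sum_(y \in setT) w x y.
Proof.
move=> /fs_fset[X wX].
pose X1 := [fset p.1 | p in X]%fset; pose X2 := [fset p.2 | p in X]%fset.
have w1 x y : x \notin X1 -> w x y = 0.
  move=> xX; apply: (wX (x, y)); apply: contra xX => xyX.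
  by apply/imfsetP; exists (x, y).
have w2 x y : y \notin X2 -> w x y = 0.
  move=> xX; apply: (wX (x, y)); apply: contra xX => xyX.
  by apply/imfsetP; exists (x, y).
rewrite (fsbigTE X1); last first.
  by move=> x xX1; apply: fsum_eq0 => y; exact: w1.
under eq_bigr => x _ do rewrite (fsbigTE X2 _ (fun y => w2 x y)).
rewrite (fsbigE [seq (x, y) | x <- X1, y <- X2])//; last 1 first.
- move=> [x y] _ /=; apply: contraNeq => wxy; apply/allpairsP; exists (x, y).
  split=> //=; first by apply: contraR wxy => /w1 ->.
  by apply: contraR wxy => /w2 ->.
- rewrite big_mkcond big_allpairs; apply: eq_bigr => x _; apply: eq_bigr => y _.
  by rewrite classical_sets.in_setT.
- by apply: allpairs_uniq => // -[? ?] [].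
Qed.

Lemma fsum_exchange (T1 T2 : choiceType) V (w : T1 -> T2 -> V) :
  fs2 w ->
  \sum_(x \in setT) \sum_(y \in setT) w x y =
  \sum_(y \in setT) \sum_(x \in setT) w x y.
Proof.
move=> wf; rewrite -(fsum_pair wf) -(fsum_pair (fs_swap wf)).
apply: (reindex_fsbigT (fun p : T2 * T1 => (p.2, p.1))).
by exists (fun p => (p.2, p.1)) => -[].
Qed.

Lemma fsum_closed T V (S : zmodClosed V) (u : T -> V) :
  (forall x, u x \in S) -> \sum_(x \in setT) u x \in S.
Proof. by move=> uS; apply: rpred_sum. Qed.

End FiniteSums.

(** * Multi-indices: order, induction, binomial and trinomial coefficients *)

Section MultiIndices.
Variable m : nat.
Implicit Types (i j p q r : mindex m) (mu : 'I_m).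

Lemma mindexP i j : (forall mu, i mu = j mu) -> i = j.
Proof. by move=> ij; apply/ffunP. Qed.

(* With (i + j) mu the entry would be typed in the additive structure of nat,
   and the lemma would not rewrite in arithmetic contexts. *)
Lemma mindexDE i j mu :
  @fun_of_fin _ (fun=> nat) (Phant _) (i + j) mu = (i mu + j mu)%N.
Proof. by rewrite ffunE. Qed.

Lemma mindex0E mu : (0 : mindex m) mu = 0%N.
Proof. by rewrite ffunE. Qed.

Lemma mleP i j : reflect (forall mu, (i mu <= j mu)%N) (mle i j).
Proof. exact: forallP. Qed.

Lemma mle_addl i j : mle j (i + j).
Proof. by apply/mleP => mu; rewrite mindexDE leq_addl. Qed.

Lemma mle_addr i j : mle i (i + j).
Proof. by rewrite addrC mle_addl. Qed.

Lemma msub_addK i j : msub (i + j) j = i.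
Proof. by apply: mindexP => mu; rewrite ffunE mindexDE addnK. Qed.

Lemma msubK i j : mle j i -> msub i j + j = i.
Proof.
by move=> /mleP ji; apply: mindexP => mu; rewrite mindexDE ffunE subnK.
Qed.

Lemma finite_mle i : finite_set [set r | mle r i].
Proof.
(* Every entry of [r] is at most the matching entry of [i], hence at most [mdeg i], so [r] comes
   from a function into a finite ordinal. *)
pose h (f : {ffun 'I_m -> 'I_(mdeg i).+1}) : mindex m := [ffun mu => val (f mu)].
apply: sub_finite_set (finite_image h (@finite_finset _ setT)) => r /= /mleP ri.
exists [ffun mu => inord (r mu)] => //; apply: mindexP => mu.
rewrite ffunE /= ffunE inordK//.
by rewrite ltnS (leq_trans (ri mu))// /mdeg (bigD1 mu)//= leq_addr.
Qed.

(** The guard describes the image of the injective translation by [r]. This is how the guarded sums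
    in [Rcoef] and [Qcoef] become free sums. *)
Lemma fsum_shift (V : zmodType) r (u : mindex m -> V) :
  \sum_(k \in setT) (if mle r k then u k else 0) =
  \sum_(j \in setT) u (j + r).
Proof.
rewrite -(fsbig_widen (range (fun j => j + r))) => //; last first.
  move=> k [_ /= nk]; case: ifP => // rk; case: nk; exists (msub k r) => //.
  exact: msubK.
rewrite fsbig_image => [|x y _ _ /(congr1 (fun i => msub i r))]; last first.
  by rewrite !msub_addK.
by apply: eq_fsbigr => j _; rewrite mle_addl.
Qed.

Lemma fs_shift (V : zmodType) r (u : mindex m -> V) : finitely_supported u ->
  finitely_supported (fun k => if mle r k then u (msub k r) else 0).
Proof.
move=> /(finite_image (fun j => j + r))/fs_finite; apply=> k.
by case: ifP => // rk uk; exists (msub k r) => //; exact: msubK.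
Qed.

Definition munit mu : mindex m := [ffun nu => (nu == mu : nat)].

(** Induction on a bound for the degree: a nonzero multi-index has a positive entry, from which one
    unit is removed. *)
Lemma mindex_ind (P : mindex m -> Prop) :
  P 0 -> (forall i mu, P i -> P (i + munit mu)) -> forall i, P i.
Proof.
move=> P0 PS i; move: {2}(mdeg i) (leqnn (mdeg i)) => n.
elim: n i => [|n IHn] i.
  rewrite leqn0 sum_nat_eq0 => /forallP i0; suff -> : i = 0 by [].
  by apply: mindexP => mu; rewrite mindex0E; apply/eqP/i0.
move=> ilen; have [[mu imu]|ni] := pselect (exists mu, (0 < i mu)%N).
  have ui : mle (munit mu) i.
    by apply/mleP => nu; rewrite ffunE; case: eqP => // ->.
  rewrite -(msubK ui); apply/PS/IHn; rewrite -ltnS (leq_trans _ ilen)//.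
  rewrite /mdeg [ltnRHS](bigD1 mu)//= (bigD1 mu)//= -addSn leq_add//.
    by rewrite !ffunE eqxx subn1 prednK.
  by apply: leq_sum => nu _; rewrite ffunE leq_subr.
suff -> : i = 0 by [].
apply: mindexP => mu; rewrite mindex0E; apply/eqP; rewrite -leqn0 leqNgt.
by apply/negP => imu; apply: ni; exists mu.
Qed.

Lemma mfact_gt0 i : (0 < mfact i)%N.
Proof. by rewrite prodn_gt0// => mu; rewrite fact_gt0. Qed.

(** Factorials multiply entrywise; when [r] is not below [i], some factor of the product vanishes,
    in agreement with the guard. *)
Lemma mbinomE i r : mbinom i r = (\prod_mu 'C(i mu, r mu))%N.
Proof.
rewrite /mbinom; case: ifP => [/mleP ri|/negbT].
  suff -> : mfact i = (\prod_mu 'C(i mu, r mu) * (mfact r * mfact (msub i r)))%N.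
    by rewrite mulnK// muln_gt0 !mfact_gt0.
  rewrite -!big_split/=; apply: eq_bigr => mu _.
  by rewrite ffunE bin_fact.
rewrite negb_forall => /existsP[mu]; rewrite -ltnNge => imu.
by rewrite (bigD1 mu)//= bin_small.
Qed.

Lemma mbinom_eq0 i r : ~~ mle r i -> mbinom i r = 0%N.
Proof. by rewrite /mbinom => /negbTE ->. Qed.

Lemma mbinom_fact p q : (mbinom (p + q)%R q * (mfact q * mfact p))%N = mfact (p + q)%R.
Proof.
rewrite mbinomE -!big_split; apply: eq_bigr => mu _ /=.
by rewrite mindexDE -{2}(addnK (q mu) (p mu)) bin_fact// leq_addl.
Qed.

(** Pascal's rule in the entry [mu]; the other factors do not change. If [r mu] is 0, truncated
    subtraction would return [r] itself, hence the guard. *)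
Lemma mbinomS i mu r : mbinom (i + munit mu) r =
  (mbinom i r + if mle (munit mu) r then mbinom i (msub r (munit mu)) else 0)%N.
Proof.
have eqs (s t : mindex m) : (forall nu, nu != mu -> s nu = t nu) ->
    (\prod_(nu | nu != mu) 'C(@fun_of_fin _ (fun=> nat) (Phant _) (i + munit mu)%R nu, s nu) =
     \prod_(nu | nu != mu) 'C(i nu, t nu))%N.
  move=> st; apply: eq_bigr => nu /[dup] numu /st ->.
  by rewrite mindexDE ffunE (negbTE numu) addn0.
have binD (s t : mindex m) : mbinom s t =
    ('C(s mu, t mu) * \prod_(nu | nu != mu) 'C(s nu, t nu))%N.
  by rewrite mbinomE (bigD1 mu).
rewrite !binD mindexDE ffunE eqxx addn1.
rewrite (eqs _ r)//; case: ifPn => [/mleP/(_ mu)|].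
  rewrite ffunE eqxx => rmu.
  rewrite -(eqs (msub r (munit mu)) (msub r (munit mu)))//.
  rewrite (eqs _ r) => [|nu /negbTE numu]; last by rewrite !ffunE numu subn0.
  by rewrite !ffunE eqxx; case: (r mu) rmu => // n _; rewrite subn1/= binS mulnDl.
rewrite negb_forall => /existsP[nu]; rewrite ffunE; case: eqP => [->|//].
by rewrite -ltnNge ltnS leqn0 => /eqP ->; rewrite !bin0 addn0.
Qed.

(** The form in which trinomials arise when the binomial Leibniz rule is applied twice. *)
Lemma mtrinomE j p q r : mtrinom j p q r =
  if p + q + r == j then (mbinom j (q + r)%R * mbinom (q + r)%R r)%N else 0%N.
Proof.
rewrite /mtrinom; case: eqP => // <-.
have <- : (mbinom (p + q + r)%R (q + r)%R * mbinom (q + r)%R r *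
    (mfact p * mfact q * mfact r))%N = mfact (p + q + r).
  rewrite -addrA -mbinom_fact -(mbinom_fact q r) -!mulnA.
  by do 2!congr muln; rewrite mulnA mulnC (mulnC (mfact p)).
by rewrite mulnK// !muln_gt0 !mfact_gt0.
Qed.

Lemma mtrinomC j p q r : mtrinom j p q r = mtrinom j p r q.
Proof. by rewrite /mtrinom addrAC mulnAC. Qed.

End MultiIndices.

(** * Iterated horizontal derivatives and their Leibniz rules *)

Section HorizontalDerivatives.
Variables (K : fieldType) (F : comAlgType K) (A : choiceType) (m : nat).
Variable DA : diffAlg F A m.
Implicit Types (i j p q r : mindex m) (mu : 'I_m) (x y z : F).

Local Notation D := (Dpow DA).

Lemma Dh_commute mu nu x : Dh DA mu (Dh DA nu x) = Dh DA nu (Dh DA mu x).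
Proof.
by apply/eqP; rewrite -subr_eq0; apply/eqP; exact: (congr1 (fun f => f x) (Dh_comm DA mu nu)).
Qed.

Lemma Dh_iter_commute mu nu a x :
  Dh DA mu (iter a (Dh DA nu) x) = iter a (Dh DA nu) (Dh DA mu x).
Proof. by elim: a => //= a IH; rewrite Dh_commute IH. Qed.

(** [Dpow] over an arbitrary list of directions, which permits induction on the list. *)
Let Ds (s : seq 'I_m) i : F -> F :=
  \big[(fun f g : F -> F => f \o g)/id]_(mu <- s) iter (i mu) (Dh DA mu).

Let Ds_nil i x : Ds [::] i x = x.
Proof. by rewrite /Ds big_nil. Qed.

Let Ds_cons mu s i x : Ds (mu :: s) i x = iter (i mu) (Dh DA mu) (Ds s i x).
Proof. by rewrite /Ds big_cons. Qed.

Let Ds_commute s i mu x : Dh DA mu (Ds s i x) = Ds s i (Dh DA mu x).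
Proof.
elim: s => [|nu s IH]; first by rewrite !Ds_nil.
by rewrite !Ds_cons Dh_iter_commute IH.
Qed.

Let Ds_unit s mu x : Ds s (munit mu) x = iter (count_mem mu s) (Dh DA mu) x.
Proof.
elim: s => [|nu s IH]; first by rewrite Ds_nil.
rewrite Ds_cons ffunE IH /= iterD; by case: eqP => // ->.
Qed.

Let Ds_unit_add s i mu x : Ds s (i + munit mu) x = Ds s i (Ds s (munit mu) x).
Proof.
elim: s x => [|nu s IH] x; first by rewrite !Ds_nil.
rewrite !Ds_cons mindexDE IH iterD; congr iter; rewrite ffunE.
by case: eqP => //= ->; rewrite Ds_commute.
Qed.

Lemma DpowS i mu x : D (i + munit mu) x = D i (Dh DA mu x).
Proof.
(* The enumeration of directions contains [mu] exactly once, so the unit contributes a single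
   [Dh DA mu]. *)
rewrite [LHS]Ds_unit_add [X in Ds _ _ X]Ds_unit count_uniq_mem ?index_enum_uniq//.
by rewrite mem_index_enum.
Qed.

Lemma Dpow_Dh i mu x : D i (Dh DA mu x) = Dh DA mu (D i x).
Proof. exact/esym/Ds_commute. Qed.

Lemma Dpow0 x : D 0 x = x.
Proof.
rewrite /Dpow -/(Ds (index_enum _) 0 x); elim: index_enum => [|nu s IH].
  by rewrite Ds_nil.
by rewrite Ds_cons IH mindex0E.
Qed.

Lemma Dpow_add i j x : D (i + j) x = D i (D j x).
Proof.
elim/mindex_ind: j x => [|j mu IH] x; first by rewrite addr0 Dpow0.
by rewrite addrA !DpowS IH.
Qed.

Lemma DpowD i : {morph D i : x y / x + y}.
Proof.
elim/mindex_ind: i => [|i mu IH] x y; first by rewrite !Dpow0.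
by rewrite !DpowS raddfD IH.
Qed.

Lemma Dpow_0r i : D i 0 = 0.
Proof. by apply: (addrI (D i 0)); rewrite -DpowD !addr0. Qed.

Lemma Dpow_fsum (T : choiceType) i (u : T -> F) : finitely_supported u ->
  D i (\sum_(t \in setT) u t) = \sum_(t \in setT) D i (u t).
Proof. by apply: fsum_morph; exact: DpowD. Qed.

Lemma fs_mbinom (u : mindex m -> F) i :
  finitely_supported (fun r => (mbinom i r)%:R * u r).
Proof.
apply: (fs_finite (finite_mle i)) => r /= h; apply: contrapT => /negP ri.
by apply: h; rewrite mbinom_eq0 ?mul0r.
Qed.

(** By induction on [i]: the extra derivative falls on [x] or on [y], and the two sums match the two
    summands of Pascal's rule. *)
Lemma Dpow_mul i x y : D i (x * y) =
  \sum_(r \in setT) (mbinom i r)%:R * (D (msub i r) x * D r y).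
Proof.
elim/mindex_ind: i x y => [|i mu IH] x y.
  rewrite (fsum_single (x0 := 0)) => [|r r0].
    rewrite !Dpow0 mbinomE big1 ?mul1r => [|mu _]; last by rewrite mindex0E bin0.
    by congr (_ * _); rewrite -[LHS](Dpow0 x); congr D; apply: mindexP => mu; rewrite !ffunE.
  rewrite mbinom_eq0 ?mul0r//; apply: contra r0 => /mleP r0.
  apply/eqP/ffunP => mu; apply/eqP; move: (r0 mu).
  by rewrite !mindex0E leqn0.
rewrite DpowS Dh_leibniz DpowD !IH.
under [RHS]fsum_eq do rewrite mbinomS natrD mulrDl.
rewrite fsumD; first last.
- apply: (fs_sub (fs_shift (munit mu) (fs_mbinom (fun=> 1) i))) => r.
  by case: ifP => _; rewrite ?mulr1 => h; rewrite ?h mul0r.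
- exact: fs_mbinom.
congr (_ + _).
  apply: fsum_eq => r; have [ri|/mbinom_eq0 ->] := boolP (mle r i); last by rewrite !mul0r.
  congr (_ * (_ * _)); rewrite -DpowS; congr D.
  apply: mindexP => nu.
  rewrite mindexDE ffunE [RHS]ffunE mindexDE addnBAC//.
  exact: (mleP _ _ ri).
(* The second Pascal summand, where the extra derivative falls on [y]; shifting [r] by [munit mu]
   removes the guard. *)
pose U r := (mbinom i (msub r (munit mu)))%:R *
  (D (msub (i + munit mu) r) x * D r y).
rewrite [RHS](_ : _ = \sum_(r \in setT) (if mle (munit mu) r then U r else 0)); last first.
  by apply: fsum_eq => r; case: ifP; rewrite ?mul0r.
rewrite fsum_shift; apply: fsum_eq => r; rewrite /U msub_addK DpowS.
congr (_ * (D _ _ * _)); apply: mindexP => nu.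
by rewrite ffunE [RHS]ffunE !mindexDE subnDr.
Qed.

(** Two applications of the binomial rule, first splitting off [y * z] with [D s], then [z] with
    [D r]; afterwards s = q + r. *)
Lemma Dpow_mul3 j x y z : D j (x * y * z) =
  \sum_(r \in setT) \sum_(q \in setT) \sum_(p \in setT)
    (mtrinom j p q r)%:R * (D p x * D q y * D r z).
Proof.
have mbinf n : finitely_supported (fun r => (mbinom n r)%:R : F).
  by have := fs_mbinom (fun=> 1) n; under eq_fun do rewrite mulr1.
have E s : (mbinom j s)%:R * (D (msub j s) x * D s (y * z)) =
    \sum_(r \in setT) (mbinom j s * mbinom s r)%:R *
      (D (msub j s) x * D (msub s r) y * D r z).
  rewrite Dpow_mul fsumMl ?fsumMl; try exact: fs_mbinom.
    by apply: fsum_eq => r; rewrite natrM; ring.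
  by apply/fs_mulr/fs_mbinom.
rewrite -mulrA Dpow_mul; under fsum_eq do rewrite E.
rewrite fsum_exchange; last first.
  apply: (fs_pair (mbinf j)) => [s r js|s].
    by rewrite natrM js !mul0r.
  by apply: fs_mull; apply: (fs_sub (mbinf s)) => r; rewrite natrM => ->; rewrite mulr0.
apply: fsum_eq => r.
pose U s := (mbinom j s * mbinom s r)%:R * (D (msub j s) x * D (msub s r) y * D r z).
rewrite [LHS](_ : _ = \sum_(s \in setT) (if mle r s then U s else 0)); last first.
  apply: fsum_eq => s; rewrite /U; case: ifPn => // rs.
  by rewrite (mbinom_eq0 rs) muln0 mul0r.
rewrite fsum_shift; apply: fsum_eq => q; rewrite /U msub_addK.
(* The condition p + q + r = j leaves only this [p]. If [q + r] is not below [j], its trinomial is 0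
   too, as is the binomial on the left. *)
rewrite (fsum_single (x0 := msub j (q + r))) => [|p pj]; last first.
  rewrite mtrinomE; case: eqP => [jE|_]; last by rewrite mul0r.
  by case/eqP: pj; rewrite -jE -addrA msub_addK.
rewrite mtrinomE; case: ifPn => // /eqP jqr.
rewrite mbinom_eq0 ?mul0n//; apply/negP => /msubK; rewrite addrA; exact: jqr.
Qed.

Lemma mtrinom_neq0 j p q r : mtrinom j p q r <> 0%N -> [/\ mle p j, mle q j & mle r j].
Proof.
rewrite mtrinomE; case: eqP => // <- _; split; first by rewrite -addrA mle_addr.
  by rewrite addrAC mle_addl.
exact: mle_addl.
Qed.

End HorizontalDerivatives.

(** * Integration by parts modulo divergences *)

Section IntegrationByParts.
Variables (K : fieldType) (F : comAlgType K) (A : choiceType) (m : nat).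
Variable DA : diffAlg F A m.
Implicit Types (i j k l p q r : mindex m) (mu : 'I_m) (x y z : F).

Local Notation D := (Dpow DA).
Local Notation M := (mindex m).

Lemma mem_eq (T : Type) (S : {pred T}) a b : a \in S -> a = b -> b \in S.
Proof. by move=> + <-. Qed.

Lemma Dh_im_Div mu x : Dh DA mu x \in im_Div DA.
Proof.
rewrite inE; apply/asboolP; exists (fun nu => if nu == mu then x else 0) => //.
rewrite /Div (bigD1 mu)//= eqxx big1 ?addr0// => nu /negbTE ->.
exact: raddf0.
Qed.

Lemma Dpow_by_parts j x y :
  x * D j y - (-1) ^+ mdeg j * D j x * y \in im_Div DA.
Proof.
elim/mindex_ind: j x y => [|j mu IH] x y.
  rewrite !Dpow0 /mdeg big1 => [|mu _]; last by rewrite mindex0E.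
  by rewrite mul1r subrr rpred0.
have -> : mdeg (j + munit mu) = (mdeg j).+1.
  rewrite /mdeg (eq_bigr (fun nu => (j nu + munit mu nu)%N)) => [|nu _]; last first.
    by rewrite mindexDE.
  rewrite big_split /= [X in (_ + X)%N](bigD1 mu)//=.
  rewrite [X in (_ + (_ + X))%N]big1 ?ffunE ?eqxx ?addn1// => nu.
  by rewrite ffunE => /negbTE ->.
(* With the sign of [j], this divergence cancels the term in [D j x * Dh DA mu y] left by the
   induction hypothesis. *)
have := Dh_im_Div mu (D j x * y); rewrite -(rpredMsign _ (mdeg j)) Dh_leibniz.
move=> /(rpredD (IH x (Dh DA mu y))); rewrite !DpowS !Dpow_Dh exprS.
by move=> h; apply: (mem_eq h); ring.
Qed.

Definition bidiff (P : M -> M -> F) y z : F :=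
  \sum_(t \in setT) P t.1 t.2 * (D t.1 y * D t.2 z).

(** Coefficients of (y, z) |-> sum of (-D)^j (P_ij y D^i z): [D p] falls on the coefficient, [D k]
    on [y], and [D (msub l i)] on [D i z]. *)
Definition by_parts_coef (P : M -> M -> F) k l : F :=
  \sum_(t \in [set: M * M * M])
    let: (i, j, p) := t in
    if mle i l then
      (-1) ^+ mdeg j * (mtrinom j p k (msub l i))%:R * D p (P i j)
    else 0.

Section Coef.
Variable P : M -> M -> F.
Hypothesis Pf : fs2 P.

Let W (ij : M * M) p (kl : M * M) : F :=
  if mle ij.1 kl.2 then
    (-1) ^+ mdeg ij.2 * (mtrinom ij.2 p kl.1 (msub kl.2 ij.1))%:R
      * D p (P ij.1 ij.2)
  else 0.

(** A nonzero trinomial forces [p] and [k] below [j], and [l] into the translate by [i] of the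
    multi-indices below [j]. *)
Let W_fs ij : fs2 (W ij).
Proof.
have f := finite_mle ij.2.
have := finite_setX f (finite_setX f (finite_image (fun r => r + ij.1) f)).
move=> /fs_finite; apply=> -[p [k l]]; rewrite /W /=; case: ifP => // il.
have [->|/eqP/mtrinom_neq0[pj kj lj] _] :=
  eqVneq (mtrinom ij.2 p k (msub l ij.1)) 0%N; first by rewrite mulr0 mul0r.
by do 2!split => //=; exists (msub l ij.1) => //; exact: msubK.
Qed.

Let W_fs2 : fs2 (fun t => W t.1 t.2).
Proof.
apply: (fs_assoc (w := W)); apply: (fs_pair Pf) => [ij pkl Pij|ij]; last exact: W_fs.
by rewrite /W Pij Dpow_0r mulr0 if_same.
Qed.

Let by_parts_coefE k l : by_parts_coef P k l = \sum_(t \in setT) W t.1 t.2 (k, l).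
Proof. by apply: fsum_eq => -[[i j] p]. Qed.

Lemma fs_by_parts_coef : fs2 (by_parts_coef P).
Proof.
apply: fs_sub (fs_fsum (fs_swap W_fs2)) _ => -[k l] /=.
by rewrite by_parts_coefE.
Qed.

(** Once the sum over [(i, j)] is outermost, the inner sums over [l], [k], [p] are the trinomial
    Leibniz expansion. *)
Lemma bidiff_by_parts_coef y z : bidiff (by_parts_coef P) y z =
  \sum_(ij \in setT)
    (-1) ^+ mdeg ij.2 * D ij.2 (P ij.1 ij.2 * y * D ij.1 z).
Proof.
pose E (kl : M * M) := D kl.1 y * D kl.2 z.
have WEf ij : fs2 (fun p kl => W ij p kl * E kl) by apply: fs_mull; exact: W_fs.
have WEf2 : fs2 (fun t kl => W t.1 t.2 kl * E kl) by apply: fs_mull; exact: W_fs2.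
transitivity (\sum_(kl \in setT) \sum_(t \in setT) W t.1 t.2 kl * E kl).
  apply: fsum_eq => -[k l]; rewrite by_parts_coefE fsumMr//.
  exact: (fs_slice _ (fs_swap W_fs2)).
rewrite -(fsum_exchange WEf2).
rewrite (fsum_pair (w := fun ij p => \sum_(kl \in setT) W ij p kl * E kl)); last first.
  exact: fs_fsum WEf2.
apply: fsum_eq => -[i j]; rewrite (fsum_exchange (WEf _)).
rewrite (fsum_pair (w := fun k l =>
  \sum_(p \in setT) W (i, j) p (k, l) * E (k, l))); last first.
  by apply: fs_sub (fs_fsum (fs_swap (WEf (i, j)))) _ => -[].
rewrite fsum_exchange; last first.
  by apply: fs_sub (fs_fsum (fs_swap (WEf (i, j)))) _ => -[].
rewrite Dpow_mul3 fsumMsign /=.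
pose U l := \sum_(k \in setT) \sum_(p \in setT)
  (-1) ^+ mdeg j * (mtrinom j p k (msub l i))%:R * D p (P i j) * (D k y * D l z).
rewrite [LHS](_ : _ = \sum_(l \in setT) (if mle i l then U l else 0)); last first.
  apply: fsum_eq => l; rewrite /W /E /U /=; case: ifP => // il.
  by apply: fsum_eq0 => k; apply: fsum_eq0 => p; rewrite mul0r.
(* Substituting l = r + i turns [D l z] into [D r (D i z)]. *)
rewrite fsum_shift; apply: fsum_eq => r; rewrite fsumMsign; apply: fsum_eq => q.
rewrite fsumMsign; apply: fsum_eq => p; rewrite !msub_addK Dpow_add.
by ring.
Qed.

(** Each pair [(i, j)] contributes one integration by parts, moving [D j] from [x] onto
    [P i j * y * D i z]. *)
Lemma bidiff_by_parts x y z :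
  y * bidiff P z x - x * bidiff (by_parts_coef P) y z \in im_Div DA.
Proof.
have Pf' (e : M * M -> F) : finitely_supported (fun t => P t.1 t.2 * e t).
  exact: fs_mull Pf.
rewrite bidiff_by_parts_coef /bidiff !fsumMl//; last first.
  by apply: (fs_sub Pf) => t ->; rewrite !mul0r Dpow_0r mulr0.
rewrite -fsumB; first last.
- by apply: (fs_sub Pf) => t ->; rewrite !mul0r Dpow_0r !mulr0.
- by apply: (fs_sub Pf) => t ->; rewrite mul0r mulr0.
apply: fsum_closed => -[i j] /=.
by apply: (mem_eq (Dpow_by_parts j (P i j * y * D i z) x)); ring.
Qed.

End Coef.

End IntegrationByParts.

(** * Bidifferential operators: transposition, vanishing, composition with derivatives *)

Section Bidifferential.
Variables (K : fieldType) (F : comAlgType K) (A : choiceType) (m : nat).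
Variable DA : diffAlg F A m.
Implicit Types (i j k l p q r : mindex m) (x y z : F).

Local Notation D := (Dpow DA).
Local Notation M := (mindex m).
Implicit Types P : M -> M -> F.

Lemma bidiff_swap P y z : bidiff DA P y z = bidiff DA (fun k l => P l k) z y.
Proof.
rewrite /bidiff (reindex_fsbigT (fun t : M * M => (t.2, t.1))).
  by apply: fsum_eq => t /=; rewrite [X in _ * X]mulrC.
by exists (fun t => (t.2, t.1)) => -[].
Qed.

(** Here [x] sits in the first slot; transposing both operators reduces this to
    [bidiff_by_parts]. *)
Lemma bidiff_by_partsr P x y z : fs2 P ->
  z * bidiff DA P x y -
    x * bidiff DA (fun k l => by_parts_coef DA (fun i j => P j i) l k) y z
    \in im_Div DA.
Proof.
move=> Pf; rewrite bidiff_swap [X in x * X]bidiff_swap.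
exact: (bidiff_by_parts DA (fs_swap Pf)).
Qed.

Lemma bidiffD P P' y z : fs2 P -> fs2 P' ->
  bidiff DA (fun k l => P k l + P' k l) y z = bidiff DA P y z + bidiff DA P' y z.
Proof.
move=> Pf Pf'; rewrite /bidiff -fsumD; try exact: fs_mull.
by apply: fsum_eq => t; rewrite mulrDl.
Qed.

Lemma bidiff0l P z : bidiff DA P 0 z = 0.
Proof. by apply: fsum_eq0 => t; rewrite Dpow_0r mul0r mulr0. Qed.

Lemma bidiff0r P y : bidiff DA P y 0 = 0.
Proof. by rewrite bidiff_swap bidiff0l. Qed.

(** For fixed [z] this is an operator in [y] with coefficients [hop DA (P k) z], which vanish by
    exactness; exactness in [z] then kills each [P k l]. *)
Lemma bidiff_eq0 P : horizontally_exact DA -> fs2 P ->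
  (forall y z, bidiff DA P y z = 0) -> forall k l, P k l = 0.
Proof.
move=> ex Pf P0 k; apply: (ex _ (fs_slice k Pf)).1 => z.
have Pzf : fs2 (fun k l => P k l * D l z) by exact: fs_mull.
apply: ((ex (fun k => hop DA (P k) z) (fs_fsum Pzf)).1 _ k) => y.
rewrite -(P0 y z) /bidiff.
rewrite (fsum_pair (w := fun k l => P k l * (D k y * D l z))); last exact: fs_mull.
apply: fsum_eq => k'; rewrite /hop fsumMr; last exact: (fs_slice k' Pzf).
by apply: fsum_eq => l; rewrite mulrAC mulrA.
Qed.

(** Leibniz puts [D (msub i r)] on the coefficient and [D r] on the derivative already present; k =
    j + r collects the terms in [D k y]. The factors [a] and [e] stand for the [J] and [pd] factors
    of [Rcoef]. *)
Lemma Dpow_hop (P : M -> F) i a e y : finitely_supported P ->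
  a * D i (hop DA P y) * e =
  \sum_(k \in setT) (\sum_(r \in setT)
    if mle r i && mle r k then
      (mbinom i r)%:R * a * D (msub i r) (P (msub k r)) * e
    else 0) * D k y.
Proof.
move=> Pf.
have binf : finitely_supported (fun r => (mbinom i r)%:R : F).
  by apply: fs_sub (fs_mbinom (fun=> 1) i) _ => r; rewrite mulr1; exact: id.
have Xf : fs2 (fun r k => if mle r i && mle r k then
    (mbinom i r)%:R * a * D (msub i r) (P (msub k r)) * e else 0).
  apply: (fs_pair binf) => [r k ->|r]; first by rewrite !mul0r if_same.
  apply: fs_sub (fs_shift r Pf) _ => k; case: (mle r k); rewrite ?andbF//.
  by move=> ->; rewrite Dpow_0r mulr0 mul0r if_same.
have XDf : fs2 (fun k r => (if mle r i && mle r k then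
    (mbinom i r)%:R * a * D (msub i r) (P (msub k r)) * e else 0) * D k y).
  by apply: fs_mull; exact: fs_swap Xf.
rewrite [RHS](_ : _ = \sum_(k \in setT) \sum_(r \in setT) (if mle r i && mle r k then
    (mbinom i r)%:R * a * D (msub i r) (P (msub k r)) * e else 0) * D k y); last first.
  by apply: fsum_eq => k; rewrite fsumMr//; exact: (fs_slice k (fs_swap Xf)).
rewrite fsum_exchange//.
have PDf : finitely_supported (fun j => P j * D j y) by exact: fs_mull.
rewrite /hop Dpow_fsum// fsumMl; last first.
  by apply: (fs_sub PDf) => j ->; rewrite Dpow_0r.
rewrite fsumMr; last by apply: (fs_sub PDf) => j ->; rewrite Dpow_0r mulr0.
rewrite [LHS](_ : _ = \sum_(j \in setT) \sum_(r \in setT) (mbinom i r)%:R *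
    (a * D (msub i r) (P j) * e * D (j + r) y)); last first.
  apply: fsum_eq => j; rewrite Dpow_mul fsumMl ?fsumMr; try exact: fs_mbinom.
    by apply: fsum_eq => r; rewrite addrC Dpow_add; ring.
  by apply: fs_mulr; exact: fs_mbinom.
rewrite [LHS]fsum_exchange; last first.
  apply: (fs_pair Pf) => [j r ->|j]; last exact: fs_mbinom.
  by rewrite Dpow_0r mulr0 !mul0r mulr0.
apply: fsum_eq => r; have [ri|nri] := boolP (mle r i); last first.
  by rewrite !fsum_eq0// => j; rewrite /= ?mul0r// mbinom_eq0// mul0r.
pose U k := (mbinom i r)%:R * a * D (msub i r) (P (msub k r)) * e * D k y.
rewrite [RHS](_ : _ = \sum_(k \in setT) (if mle r k then U k else 0)); last first.
  by apply: fsum_eq => k /=; case: ifP; rewrite ?mul0r.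
rewrite fsum_shift; apply: fsum_eq => j; rewrite /U msub_addK; ring.
Qed.

End Bidifferential.

(** * Evolutionary derivations and their commutators with operators *)

Section Evolutionary.
Variables (K : fieldType) (F : comAlgType K) (A : choiceType) (m : nat).
Variable DA : diffAlg F A m.
Implicit Types (phi : A -> F) (x y : F) (i : mindex m).

Local Notation D := (Dpow DA).
Local Notation M := (mindex m).

Let fs_ev phi x : finitely_supported (fun a => phi a * pd DA a x).
Proof. by apply: fs_mulr; exact: pd_fin. Qed.

Lemma ev_add phi : {morph ev DA phi : x y / x + y}.
Proof.
move=> x y; rewrite /ev /formal_field -fsumD//.
by apply: fsum_eq => a; rewrite raddfD mulrDr.
Qed.

Lemma ev0 phi : ev DA phi 0 = 0.
Proof. by apply: fsum_eq0 => a; rewrite raddf0 mulr0. Qed.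

Lemma ev_mul phi x y : ev DA phi (x * y) = ev DA phi x * y + x * ev DA phi y.
Proof.
rewrite /ev /formal_field fsumMr// fsumMl// -fsumD; first last.
- by apply: fs_sub (fs_ev phi y) _ => a ->; rewrite mulr0.
- by apply: fs_sub (fs_ev phi x) _ => a ->; rewrite mul0r.
by apply: fsum_eq => a; rewrite pd_leibniz; ring.
Qed.

(** The bracket of [Dh DA mu] with phi^a d_a is the vertical field with components
    [nabla DA phi b mu], which vanish. *)
Lemma ev_Dh phi mu x : ker_nabla DA phi ->
  ev DA phi (Dh DA mu x) = Dh DA mu (ev DA phi x).
Proof.
move=> kphi; rewrite /ev /formal_field (fsum_morph (raddfD (Dh DA mu)))//.
(* [pd_fin] leaves finitely many [b], and for each of them [Gam_fin] leaves finitely many [a]. *)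
have Gf : fs2 (fun a b => phi a * (Gam DA mu a b * pd DA b x)).
  apply: fs_swap; apply: (fs_pair (pd_fin DA x)) => [b a ->|b].
    by rewrite !mulr0.
  apply: fs_mulr; apply: fs_mull.
  exact: (fs_slice (w := fun mu a => Gam DA mu a b) mu (Gam_fin DA b)).
pose G a := \sum_(b \in setT) phi a * (Gam DA mu a b * pd DA b x).
have Gff : finitely_supported G := fs_fsum Gf.
have E a : Dh DA mu (phi a * pd DA a x) =
    phi a * pd DA a (Dh DA mu x) + (Dh DA mu (phi a) * pd DA a x + G a).
  rewrite Dh_leibniz addrCA; congr (_ + _).
  have := congr1 (fun f => f x) (Gam_def DA mu a).
  rewrite /lie_bracket /formal_field => /(canRL (subrK _)) ->.
  rewrite mulrDr [LHS]addrC; congr (_ + _).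
  by apply: fsumMl; apply: fs_mulr; exact: pd_fin.
have Df : finitely_supported (fun a => Dh DA mu (phi a) * pd DA a x).
  by apply: fs_mulr; exact: pd_fin.
rewrite [RHS](fsum_eq E).
rewrite fsumD//; last exact: fs_add.
rewrite fsumD// [X in _ + (_ + X)]fsum_exchange//.
rewrite -fsumD//; last exact: fs_fsum (fs_swap Gf).
rewrite [X in _ + X]fsum_eq0 ?addr0// => b.
have Gbf : finitely_supported (fun a => Gam DA mu a b * phi a).
  apply: fs_mull.
  exact: (fs_slice (w := fun mu a => Gam DA mu a b) mu (Gam_fin DA b)).
(* After the exchange of sums, the total coefficient of [pd DA b x] is this component of [nabla]. *)
have kE : nabla DA phi b mu * pd DA b x = 0 by rewrite kphi mul0r.
rewrite -[RHS]kE /nabla mulrDl fsumMr//.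
by congr (_ + _); apply: fsum_eq => a; ring.
Qed.

Lemma ev_Dpow phi i x : ker_nabla DA phi ->
  ev DA phi (D i x) = D i (ev DA phi x).
Proof.
move=> kphi; elim/mindex_ind: i x => [|i mu IH] x; first by rewrite !Dpow0.
by rewrite !DpowS IH ev_Dh.
Qed.

(** [ev] is a derivation commuting with every [D i], so the terms where it acts on [h] cancel in the
    commutator. *)
Lemma ev_commutator_hop_mx (B C : choiceType) (P : B -> C -> M -> F) phi h b :
  (forall c, finitely_supported (P b c)) -> ker_nabla DA phi ->
  finitely_supported h ->
  ev_commutator DA phi (hop_mx DA P) h b =
  \sum_(x \in setT) ev DA phi (P b x.1 x.2) * D x.2 (h x.1).
Proof.
move=> Pf kphi hf; rewrite /ev_commutator /ev_fam /hop_mx.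
have f : fs2 (fun c i => P b c i * D i (h c)).
  apply: (fs_pair hf) => [c i ->|c]; first by rewrite Dpow_0r mulr0.
  exact: fs_mull.
have f1 : fs2 (fun c i => ev DA phi (P b c i) * D i (h c)).
  apply: (fs_pair hf) => [c i ->|c]; first by rewrite Dpow_0r mulr0.
  by apply: fs_mull; apply: (fs_sub (Pf c)) => i ->; exact: ev0.
have f2 : fs2 (fun c i => P b c i * D i (ev DA phi (h c))).
  apply: (fs_pair hf) => [c i ->|c]; first by rewrite ev0 Dpow_0r mulr0.
  exact: fs_mull.
rewrite (fsum_morph (@ev_add phi))//.
have E (x : C * M) : ev DA phi (P b x.1 x.2 * D x.2 (h x.1)) =
    ev DA phi (P b x.1 x.2) * D x.2 (h x.1)
    + P b x.1 x.2 * D x.2 (ev DA phi (h x.1)).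
  by rewrite ev_mul ev_Dpow.
by under fsum_eq do rewrite E; rewrite fsumD// addrK.
Qed.

End Evolutionary.

(** * The Jacobi sum and its coefficients *)

Section JacobiIdentity.
Variables (K : fieldType) (F : comAlgType K) (A : choiceType) (m : nat).
Variable DA : diffAlg F A m.
Variable I : choiceType.
Variables (J : A -> I -> mindex m -> F) (Lam : I -> I -> mindex m -> F).
Hypothesis Jf : forall a, fs2 (J a).
Hypothesis Lamf : forall al be, finitely_supported (Lam al be).
Implicit Types (x y z L : F) (f g h : I -> F).

Local Notation D := (Dpow DA).
Local Notation M := (mindex m).

(* Rcoef with \Lambda^{\alpha\gamma}_l replaced by an arbitrary L; it gives
   the operator g |-> ev_{phi(g)} L. *)
Let evcoef L be k : F := \sum_(x \in [set: A * I * M * M])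
  let: (a, ep, i, r) := x in
  if mle r i && mle r k then
    (mbinom i r)%:R * J a ep i * D (msub i r) (Lam ep be (msub k r)) * pd DA a L
  else 0.

Let X L be (t : A * I * M) r k : F :=
  if mle r t.2 && mle r k then
    (mbinom t.2 r)%:R * J t.1.1 t.1.2 t.2
      * D (msub t.2 r) (Lam t.1.2 be (msub k r)) * pd DA t.1.1 L
  else 0.

Let evcoefE L be k :
  evcoef L be k = \sum_(tr \in setT) X L be tr.1 tr.2 k.
Proof. by apply: fsum_eq => -[[[a ep] i] r]. Qed.

(** [pd_fin] leaves finitely many [a], and [Jf] finitely many [(ep, i)] for each. Sums over
    [(a, ep, i)] inherit finiteness from this factor. *)
Let c_fs L :
  finitely_supported (fun t : A * I * M => J t.1.1 t.1.2 t.2 * pd DA t.1.1 L).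
Proof.
apply: (fs_assoc (w := fun a ep i => J a ep i * pd DA a L)).
apply: (fs_pair (pd_fin DA L)) => [a epi ->|a]; first by rewrite mulr0.
exact: fs_mull (Jf a).
Qed.

Let X_fs L be t : fs2 (X L be t).
Proof.
apply: (fs_pair (u := fun r => (mbinom t.2 r)%:R : F)).
- by apply: fs_sub (fs_mbinom (fun=> 1) t.2) _ => r; rewrite mulr1; exact: id.
- by move=> r k tr; rewrite /X tr !mul0r if_same.
move=> r; apply: fs_sub (fs_shift r (Lamf t.1.2 be)) _ => k.
rewrite /X; case: (mle r k); rewrite ?andbF// => ->.
by rewrite Dpow_0r mulr0 mul0r if_same.
Qed.

Let X0 L be t r k : J t.1.1 t.1.2 t.2 * pd DA t.1.1 L = 0 -> X L be t r k = 0.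
Proof.
move=> ct; rewrite /X; case: ifP => // _.
rewrite [LHS](_ : _ = (J t.1.1 t.1.2 t.2 * pd DA t.1.1 L) *
  ((mbinom t.2 r)%:R * D (msub t.2 r) (Lam t.1.2 be (msub k r)))).
  by rewrite ct mul0r.
by ring.
Qed.

Let X_fs_trk L be : fs2 (fun tr k => X L be tr.1 tr.2 k).
Proof.
apply: (fs_assoc (w := X L be)); apply: (fs_pair (c_fs L)) => [t rk|t].
  exact: X0.
exact: X_fs.
Qed.

Let X_fs_tkr L be : fs2 (fun tk r => X L be tk.1 r tk.2).
Proof.
apply: (fs_assoc (w := fun t k r => X L be t r k)).
apply: (fs_pair (c_fs L)) => [t kr|t]; first exact: X0.
exact: fs_swap (X_fs L be t).
Qed.

Let evcoef_fs L be : finitely_supported (evcoef L be).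
Proof.
apply: fs_sub (fs_fsum (fs_swap (X_fs_trk L be))) _ => k.
by rewrite evcoefE.
Qed.

Let evcoef0 be k : evcoef 0 be k = 0.
Proof.
rewrite evcoefE; apply: fsum_eq0 => tr; apply: X0.
by rewrite raddf0 mulr0.
Qed.

Let hop_evcoef L be y : hop DA (evcoef L be) y =
  \sum_(t \in setT) J t.1.1 t.1.2 t.2 * D t.2 (hop DA (Lam t.1.2 be) y)
    * pd DA t.1.1 L.
Proof.
under [RHS]fsum_eq do rewrite Dpow_hop//.
have tk_fs : fs2 (fun t k => \sum_(r \in setT) X L be t r k) := fs_fsum (X_fs_tkr L be).
rewrite fsum_exchange; last exact: fs_mull tk_fs.
apply: fsum_eq => k; rewrite -fsumMr; last exact: (fs_slice k (fs_swap tk_fs)).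
congr (_ * _); rewrite evcoefE.
by rewrite (fsum_pair (w := fun t r => X L be t r k))//;
  exact: (fs_slice k (fs_swap (X_fs_trk L be))).
Qed.

Let hop_mxE (g : I -> F) ep : finitely_supported g ->
  hop_mx DA Lam g ep = \sum_(be \in setT) hop DA (Lam ep be) (g be).
Proof.
move=> gf; apply: (fsum_pair (w := fun be j => Lam ep be j * D j (g be))).
apply: (fs_pair gf) => [be j ->|be]; first by rewrite Dpow_0r mulr0.
exact: fs_mull.
Qed.

Let hop0 (P : M -> F) : hop DA P 0 = 0.
Proof. by apply: fsum_eq0 => i; rewrite Dpow_0r mulr0. Qed.

Let hop_coef0 (P : M -> F) y : (forall i, P i = 0) -> hop DA P y = 0.
Proof. by move=> P0; apply: fsum_eq0 => i; rewrite P0 mul0r. Qed.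

Let ev_phi_of L g : finitely_supported g ->
  ev DA (phi_of DA J Lam g) L = \sum_(be \in setT) hop DA (evcoef L be) (g be).
Proof.
move=> gf; under [RHS]fsum_eq do rewrite hop_evcoef.
have G_fs : fs2 (fun (t : A * I * M) be => J t.1.1 t.1.2 t.2 *
    D t.2 (hop DA (Lam t.1.2 be) (g be)) * pd DA t.1.1 L).
  apply: (fs_pair (c_fs L)) => [t be ct|t].
    by rewrite mulrAC ct mul0r.
  by apply: (fs_sub gf) => be ->; rewrite hop0 Dpow_0r mulr0 mul0r.
rewrite -(fsum_exchange G_fs).
(* A middle form that keeps the sum over [be] inside [hop_mx]: distributing [D i] over it gives the
   right side, and regrouping by [a] gives [ev]. *)
pose w a ep i := J a ep i * D i (hop_mx DA Lam g ep) * pd DA a L.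
have w_fs : fs2 (fun a epi => w a epi.1 epi.2).
  apply: (fs_pair (pd_fin DA L)) => [a epi|a]; first by rewrite /w => ->; rewrite mulr0.
  by apply: fs_mull; apply: fs_mull; exact: Jf.
transitivity (\sum_(t \in setT) w t.1.1 t.1.2 t.2); last first.
  apply: fsum_eq => -[[a ep] i]; rewrite /w /= hop_mxE//.
  have hf : finitely_supported (fun be => hop DA (Lam ep be) (g be)).
    by apply: (fs_sub gf) => be ->; exact: hop0.
  rewrite Dpow_fsum// fsumMl; last by apply: (fs_sub hf) => be ->; exact: Dpow_0r.
  by rewrite fsumMr//; apply: (fs_sub hf) => be ->; rewrite Dpow_0r mulr0.
rewrite (reindex_fsbigT (fun s : A * (I * M) => (s.1, s.2.1, s.2.2))); last first.
  by exists (fun t => (t.1.1, (t.1.2, t.2))) => [[? []]|[[]]].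
rewrite /= (fsum_pair w_fs); apply: fsum_eq => a.
rewrite /phi_of /hop_mx fsumMr//; exact: fs_mull (Jf a).
Qed.

(** Only finitely many [l] have [Lam al ga l] nonzero, and for each of them [evcoef] has finitely
    many nonzero [k]. *)
Lemma fs_Rcoef al be ga : fs2 (Rcoef DA J Lam al be ga).
Proof.
apply: (fs_swap (w := fun l k => evcoef (Lam al ga l) be k)).
apply: (fs_pair (Lamf al ga)) => [l k ->|l]; first exact: evcoef0.
exact: evcoef_fs.
Qed.

Local Notation R := (Rcoef DA J Lam).

(** [ev_phi_of] is applied with [L] equal to [Lam al ga l], for which [evcoef] is [Rcoef]. *)
Lemma pairing_commutator f g h :
  ker_nabla DA (phi_of DA J Lam g) ->
  finitely_supported f -> finitely_supported g -> finitely_supported h ->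
  pairing f (ev_commutator DA (phi_of DA J Lam g) (hop_mx DA Lam) h) =
  \sum_(s \in [set: I * (I * I)])
    f s.1 * bidiff DA (R s.1 s.2.1 s.2.2) (g s.2.1) (h s.2.2).
Proof.
move=> kphi ff gf hf.
have bf al : fs2 (fun be ga => bidiff DA (R al be ga) (g be) (h ga)).
  apply: (fs_pair gf) => [be ga ->|be]; first exact: bidiff0l.
  by apply: (fs_sub hf) => ga ->; exact: bidiff0r.
rewrite (fsum_pair (w := fun al s =>
  f al * bidiff DA (R al s.1 s.2) (g s.1) (h s.2))); last first.
  apply: (fs_pair ff) => [al s ->|al]; first by rewrite mul0r.
  by apply: fs_mulr; exact: bf.
apply: fsum_eq => al; rewrite -fsumMl; last exact: bf.
congr (_ * _); rewrite ev_commutator_hop_mx//.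
rewrite (fsum_pair (bf al)) (fsum_exchange (bf al)).
have evf : fs2 (fun ga l => ev DA (phi_of DA J Lam g) (Lam al ga l) * D l (h ga)).
  apply: (fs_pair hf) => [ga l ->|ga]; first by rewrite Dpow_0r mulr0.
  by apply: fs_mull; apply: (fs_sub (Lamf al ga)) => l ->; exact: ev0.
rewrite (fsum_pair evf); apply: fsum_eq => ga.
have hopf : fs2 (fun l be => hop DA (evcoef (Lam al ga l) be) (g be)).
  apply: (fs_pair (Lamf al ga)) => [l be ->|l].
    by apply: hop_coef0 => k; exact: evcoef0.
  by apply: (fs_sub gf) => be ->; exact: hop0.
have E l : ev DA (phi_of DA J Lam g) (Lam al ga l) * D l (h ga) =
    \sum_(be \in setT) hop DA (evcoef (Lam al ga l) be) (g be) * D l (h ga).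
  by rewrite ev_phi_of// fsumMr//; exact: (fs_slice l hopf).
under fsum_eq do rewrite E.
rewrite fsum_exchange; last exact: fs_mull hopf.
apply: fsum_eq => be; rewrite bidiff_swap /bidiff.
have Rf := fs_swap (fs_Rcoef al be ga).
rewrite (fsum_pair (w := fun l k => R al be ga k l * (D l (h ga) * D k (g be)))).
  apply: fsum_eq => l; rewrite /hop fsumMr; last by apply: fs_mull; exact: evcoef_fs.
  by apply: fsum_eq => k; rewrite -mulrA [X in _ * X]mulrC.
exact: fs_mull Rf.
Qed.

Local Notation Q := (Qcoef DA J Lam).

(** The third summand is the transpose of the second construction: [i] and [j] trade places, as do
    the last two trinomial entries. *)
Lemma QcoefE al be ga k l : Q al be ga k l =
  R al be ga k l + by_parts_coef DA (R be ga al) k l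
  + by_parts_coef DA (fun i j => R ga al be j i) l k.
Proof.
rewrite /Qcoef; congr (_ + _ + _).
rewrite /by_parts_coef (reindex_fsbigT (fun t : M * M * M => (t.1.2, t.1.1, t.2))).
  by apply: fsum_eq => -[[i j] p] /=; rewrite mtrinomC.
by exists (fun t => (t.1.2, t.1.1, t.2)) => -[[]].
Qed.

Lemma fs_by_parts_R al be ga :
  fs2 (fun k l => by_parts_coef DA (fun i j => R ga al be j i) l k).
Proof. by apply: fs_swap; apply: fs_by_parts_coef; apply: fs_swap; exact: fs_Rcoef. Qed.

Lemma fs_Qcoef al be ga : fs2 (Q al be ga).
Proof.
rewrite /fs2; under eq_fun do rewrite QcoefE.
apply: fs_add; last exact: fs_by_parts_R.
by apply: fs_add; [exact: fs_Rcoef | apply: fs_by_parts_coef; exact: fs_Rcoef].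
Qed.

(** The [R al be ga] terms cancel, and the rest is the sum of two integrations by parts freeing [x]
    of derivatives. *)
Lemma bidiff_Qcoef al be ga x y z :
  x * bidiff DA (R al be ga) y z + y * bidiff DA (R be ga al) z x
  + z * bidiff DA (R ga al be) x y - x * bidiff DA (Q al be ga) y z \in im_Div DA.
Proof.
have -> : bidiff DA (Q al be ga) y z = bidiff DA (fun k l =>
    R al be ga k l + by_parts_coef DA (R be ga al) k l
    + by_parts_coef DA (fun i j => R ga al be j i) l k) y z.
  by apply: fsum_eq => t; rewrite QcoefE.
have R2f : fs2 (by_parts_coef DA (R be ga al)) := fs_by_parts_coef DA (fs_Rcoef _ _ _).
rewrite bidiffD; last exact: fs_by_parts_R; last first.
  by apply: fs_add; [exact: fs_Rcoef | exact: R2f].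
rewrite bidiffD//; last exact: fs_Rcoef.
have := rpredD (bidiff_by_parts DA (fs_Rcoef be ga al) x y z)
  (bidiff_by_partsr DA x y z (fs_Rcoef ga al be)).
by move=> S; apply: (mem_eq S); ring.
Qed.

Lemma functional_int_add x y :
  functional_int DA (x + y) = functional_int DA x + functional_int DA y.
Proof. by rewrite /functional_int !piE. Qed.

Lemma functional_int_eq x y :
  x - y \in im_Div DA -> functional_int DA x = functional_int DA y.
Proof. by rewrite Quotient.idealrBE => /eqP. Qed.

Lemma jacobi_sum f g h :
  (forall chi, ker_nabla DA (hop_mx DA J chi)) ->
  finitely_supported f -> finitely_supported g -> finitely_supported h ->
  jacobi_term DA J Lam f g h + jacobi_term DA J Lam g h f
    + jacobi_term DA J Lam h f g =
  functional_int DA (\sum_(s \in [set: I * (I * I)])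
    f s.1 * bidiff DA (Q s.1 s.2.1 s.2.2) (g s.2.1) (h s.2.2)).
Proof.
move=> kJ ff gf hf; rewrite /jacobi_term -!functional_int_add.
apply: functional_int_eq; rewrite !pairing_commutator//; try exact: kJ.
have fs3 (w : I * (I * I) -> F) : (forall s, f s.1 = 0 -> w s = 0) ->
    (forall s, g s.2.1 = 0 -> w s = 0) -> (forall s, h s.2.2 = 0 -> w s = 0) ->
    finitely_supported w.
  move=> wf wg wh; apply: (fs_finite (finite_setX ff (finite_setX gf hf))).
  by move=> s ws; do 2?split=> /=; [move=> /wf | move=> /wg | move=> /wh].
(* Cyclic relabelling of the triples, after which [f], [g], [h] carry the same three indices in all
   sums and the comparison is termwise. *)
rewrite [X in _ + X + _ - _](reindex_fsbigT
  (fun s : I * (I * I) => (s.2.1, (s.2.2, s.1)))); last first.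
  by exists (fun s => (s.2.2, (s.1, s.2.1))) => -[? []].
rewrite [X in _ + _ + X - _](reindex_fsbigT
  (fun s : I * (I * I) => (s.2.2, (s.1, s.2.1)))); last first.
  by exists (fun s => (s.2.1, (s.2.2, s.1))) => -[? []].
have w1 : finitely_supported (fun s : I * (I * I) =>
    f s.1 * bidiff DA (R s.1 s.2.1 s.2.2) (g s.2.1) (h s.2.2)).
  by apply: fs3 => s ->; rewrite ?bidiff0l ?bidiff0r ?mul0r ?mulr0.
have w2 : finitely_supported (fun s : I * (I * I) =>
    g s.2.1 * bidiff DA (R s.2.1 s.2.2 s.1) (h s.2.2) (f s.1)).
  by apply: fs3 => s ->; rewrite ?bidiff0l ?bidiff0r ?mul0r ?mulr0.
have w3 : finitely_supported (fun s : I * (I * I) =>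
    h s.2.2 * bidiff DA (R s.2.2 s.1 s.2.1) (f s.1) (g s.2.1)).
  by apply: fs3 => s ->; rewrite ?bidiff0l ?bidiff0r ?mul0r ?mulr0.
have wQ : finitely_supported (fun s : I * (I * I) =>
    f s.1 * bidiff DA (Q s.1 s.2.1 s.2.2) (g s.2.1) (h s.2.2)).
  by apply: fs3 => s ->; rewrite ?bidiff0l ?bidiff0r ?mul0r ?mulr0.
rewrite -(fsumD w1 w2) -(fsumD (fs_add w1 w2) w3).
rewrite -(fsumB (fs_add (fs_add w1 w2) w3) wQ).
by apply: fsum_closed => s; exact: bidiff_Qcoef.
Qed.

Lemma jacobi_iff_Qcoef :
  horizontally_exact DA -> du_bois_reymond DA ->
  (forall chi, ker_nabla DA (hop_mx DA J chi)) ->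
  (forall f g h,
     finitely_supported f -> finitely_supported g -> finitely_supported h ->
     jacobi_term DA J Lam f g h + jacobi_term DA J Lam g h f
       + jacobi_term DA J Lam h f g = 0) <->
  (forall al be ga k l, Q al be ga k l = 0).
Proof.
move=> ex dBR kJ; split=> [jac al be ga|Q0 f g h ff gf hf]; last first.
  rewrite jacobi_sum// fsum_eq0 => [|s].
    apply/functional_int_eq0; exists (fun=> 0).
    by rewrite /Div big1// => mu _; rewrite raddf0.
  by rewrite [X in _ * X]fsum_eq0 ?mulr0// => t; rewrite Q0 mul0r.
apply: (bidiff_eq0 ex (fs_Qcoef al be ga)) => y z; apply: (dBR _).1 => x.
(* Test families concentrated at [al], [be] and [ga] leave a single triple in the Jacobi sum. *)
pose delta (a : I) (u : F) b := if b == a then u else 0.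
have deltaf a u : finitely_supported (delta a u).
  apply: (fs_finite (finite_set1 a)) => b; rewrite /delta.
  by case: eqP.
have := jac _ _ _ (deltaf al x) (deltaf be y) (deltaf ga z).
rewrite jacobi_sum// (fsum_single (x0 := (al, (be, ga)))) => [|[a [b c]]].
  by rewrite /delta /= !eqxx mulrC.
rewrite /delta !xpair_eqE /=; case: eqP => [->|_ _]; last by rewrite mul0r.
case: eqP => [->|_ _]; last by rewrite bidiff0l mulr0.
by case: eqP => // _ _; rewrite bidiff0r mulr0.
Qed.

End JacobiIdentity.

Theorem theorem1 (R : realType) (K : fieldType)
  (hK : K = (R : fieldType) \/ K = (R[i] : fieldType))
  (F : comAlgType K) (A : choiceType) (m : nat) (hm : (0 < m)%N)
  (DA : diffAlg F A m)
  (hexact : horizontally_exact DA) (hdBR : du_bois_reymond DA)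
  (I : choiceType)
  (J : A -> I -> mindex m -> F)
  (hJfin : forall a, finitely_supported (fun x : I * mindex m => J a x.1 x.2))
  (hJker : forall chi : I -> F, ker_nabla DA (hop_mx DA J chi))
  (hJev : forall phi : A -> F, ker_nabla DA phi ->
     forall (chi : I -> F) (a : A),
       ev_commutator DA phi (hop_mx DA J) chi a = 0)
  (Lam : I -> I -> mindex m -> F)
  (hLamfin : forall al be, finitely_supported (Lam al be))
  (hskew : skew_adjoint DA Lam) :
  (forall f g h : I -> F,
     finitely_supported f -> finitely_supported g -> finitely_supported h ->
     jacobi_term DA J Lam f g h + jacobi_term DA J Lam g h f
       + jacobi_term DA J Lam h f g = 0)
  <->
  (forall (al be ga : I) (k l : mindex m), Qcoef DA J Lam al be ga k l = 0).
Proof. exact: jacobi_iff_Qcoef. Qed.
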